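(* Let $(L/K,v)$ be a simple algebraic extension of valued fields such that $\epsilon(L/K,v)=e(L/K,v)$. Let $\eta$ be a generator of $L/K$, let $\nu$ be the valuation of $K[x]$ defined by $\nu(f)=v(f(\eta))$, and let $\mathbf{Q}=\{Q_i\}_{i\in I}\subseteq K[x]$ be a complete set for $\nu$. Then for each $\lambda\in\mathbb{N}_0^I$ there exists $a_\lambda\in K\setminus\{0\}$ such that $\mathcal{O}_L$ is generated, as an $\mathcal{O}_K$-module, by the set $$\left\{\frac{\mathbf{Q}(\eta)^\lambda}{a_\lambda}\ \middle|\ \lambda\in\mathbb{N}_0^I\right\}.$$
   Context: Valuations are written additively, with $v(0)=\infty$; a valuation of $K[x]$ may take the value $\infty$ on nonzero polynomials. A valued field extension $(L/K,v)$ is a field extension $L/K$ with a valuation $v$ of $L$ (also denoting its restriction to $K$). $\mathcal{O}_L,\mathcal{O}_K$ are the valuation rings and $vL,vK$ the value groups. The extension is simple algebraic if $L=K(\eta)$ for some $\eta$ algebraic over $K$; such an $\eta$ is called a generator. $e(L/K,v)=(vL:vK)$ is the ramification index. For a (totally) ordered abelian group $\Gamma$ and a subgroup $\Delta$, the initial index is $\epsilon(\Gamma|\Delta)=|\{\gamma\in\Gamma\mid 0\le\gamma<\Delta_{>0}\}|$, where $\Delta_{>0}$ is the set of positive elements of $\Delta$ and $\gamma<\Delta_{>0}$ means $\gamma<\delta$ for all $\delta\in\Delta_{>0}$. Put $\epsilon(L/K,v)=\epsilon(vL|vK)$. For a monic $q\in K[x]\setminus K$, every $f\in K[x]$ has a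 unique $q$-expansion $f=f_0+f_1q+\ldots+f_rq^r$ with $\deg(f_\ell)<\deg(q)$ for all $\ell$. For a valuation $\mu$ of $K[x]$, the truncation of $\mu$ at $q$ is $\mu_q(f)=\min_{0\le\ell\le r}\{\mu(f_\ell q^\ell)\}$. A set $\mathbf{Q}$ of monic nonconstant polynomials in $K[x]$ is a complete set for $\mu$ if for every $f\in K[x]\setminus K$ there exists $q\in\mathbf{Q}$ with $\deg(q)\le\deg(f)$ and $\mu(f)=\mu_q(f)$. $\mathbb{N}_0$ is the set of nonnegative integers and $\mathbb{N}_0^I$ is the set of maps $\lambda:I\to\mathbb{N}_0$ with $\lambda(i)=0$ for all but finitely many $i\in I$. For $\lambda\in\mathbb{N}_0^I$, $\mathbf{Q}(\eta)^\lambda=\prod_{i\in I}Q_i(\eta)^{\lambda(i)}\in L$. *)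

(* Defs.v *)
From mathcomp Require Import all_boot all_order all_algebra all_field.
From mathcomp Require Import finmap.
From mathcomp Require Import boolp classical_sets functions cardinality.

Set Implicit Arguments.
Unset Strict Implicit.
Unset Printing Implicit Defensive.

Import Order.TTheory GRing.Theory Num.Theory.
Local Open Scope classical_set_scope.
Local Open Scope ring_scope.

(* Totally ordered abelian groups, written additively. *)
Structure oagType := OagType {
  oag_sort :> porderZmodType;
  oag_le_total : total (<=%R : rel oag_sort);
  oag_leD2l : forall x y z : oag_sort, x <= y -> z + x <= z + y
}.

(* [option G] stands for G with a largest element infinity, namely [None]. *)
Section WithInfinity.
Variable G : oagType.
Implicit Types x y : option G.

Definition vadd x y : option G :=
  if x is Some g then (if y is Some h then Some (g + h) else None) else None.

Definition vle x y : bool :=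
  if y is Some h then (if x is Some g then g <= h else false) else true.

Definition vmin x y : option G := if vle x y then x else y.

End WithInfinity.

(* Nonzero elements may have value [None]; when R is a field, the axioms imply
   that [None] is the value of 0 only. *)
Record is_valuation (R : nzRingType) (G : oagType) (v : R -> option G) : Prop :=
  IsValuation {
    valuation0 : v 0 = None;
    valuation1 : v 1 = Some 0;
    valuationM : forall x y, v (x * y) = vadd (v x) (v y);
    valuationD : forall x y, vle (vmin (v x) (v y)) (v (x + y))
  }.

Definition valuation_ring (R : nzRingType) (G : oagType) (v : R -> option G) :
    set R :=
  [set x | vle (Some 0) (v x)].

Definition value_group (R : nzRingType) (G : oagType) (v : R -> option G) :
    set G :=
  [set g | exists x, v x = Some g].

(* The initial index of (Gam | Del) is the cardinality of this set. *)
Definition initial_part (G : oagType) (Gam Del : set G) : set G :=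
  [set g | [/\ Gam g, 0 <= g & forall d, Del d -> 0 < d -> g < d]].

(* Gam / Del; the index (Gam : Del) is the cardinality of this set. *)
Definition cosets (G : oagType) (Gam Del : set G) : set (set G) :=
  [set [set g + d | d in Del] | g in Gam].

Section Truncation.
Variables (K : fieldType) (G : oagType).
Implicit Types (f q : {poly K}) (mu : {poly K} -> option G).

(* The coefficient of q ^+ l in the q-expansion of f; see [qexpansion] and
   [qexpansion_uniq]. *)
Definition qcoef q f (l : nat) : {poly K} := (f %/ q ^+ l) %% q.

Lemma size_qcoef q f l : (1 < size q)%N -> (size (qcoef q f l) < size q)%N.
Proof.
by move=> q1; rewrite ltn_modp -size_poly_gt0; apply: ltn_trans q1.
Qed.

Lemma qexpansion q f : (1 < size q)%N ->
  f = \sum_(l < size f) qcoef q f l * q ^+ l.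
Proof.
move=> q1; have q0 : q != 0 by rewrite -size_poly_gt0 (ltn_trans _ q1).
have partial n :
    f = (f %/ q ^+ n) * q ^+ n + \sum_(l < n) qcoef q f l * q ^+ l.
  elim: n => [|n IHn]; first by rewrite big_ord0 expr0 divp1 mulr1 addr0.
  rewrite big_ord_recr /= addrA [RHS]addrAC {1}IHn; congr (_ + _).
  have -> : f %/ q ^+ n.+1 = f %/ q ^+ n %/ q by rewrite exprSr divp_divl.
  by rewrite /qcoef exprS mulrA -mulrDl -divp_eq.
rewrite {1}(partial (size f)) divp_small ?mul0r ?add0r //.
have qn0 : (0 < size (q ^+ size f))%N by rewrite size_poly_gt0 expf_neq0.
rewrite -(prednK qn0) ltnS size_exp leq_pmull //.
by rewrite -subn1 subn_gt0.
Qed.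

Lemma qexpansion_uniq q (n : nat) (c : nat -> {poly K}) l : (1 < size q)%N ->
    (forall i, size (c i) < size q)%N -> (l < n)%N ->
  qcoef q (\sum_(i < n) c i * q ^+ i) l = c l.
Proof.
move=> q1; have q0 : q != 0 by rewrite -size_poly_gt0 (ltn_trans _ q1).
elim: l n c => [|l IHl] [|n] c cq // ln; rewrite big_ord_recl /= expr0 mulr1.
  rewrite /qcoef expr0 divp1 modpD modp_small // modp_eq0 ?addr0 //.
  apply: (big_ind (fun p => q %| p)) => [|x y qx qy|i _]; first exact: dvdp0.
    by rewrite dvdp_addr.
  by rewrite exprSr mulrA dvdp_mull.
rewrite -[c l.+1](IHl n (c \o S)) //; last by move=> i; apply: cq.
rewrite /qcoef exprS -divp_divl divpD (divp_small (cq _)) add0r.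
congr ((_ %/ _) %% _).
under eq_bigr do rewrite /bump /= add1n exprSr mulrA.
by rewrite -mulr_suml mulpK.
Qed.

(* The index l may exceed the length of the q-expansion: the extra terms are
   mu 0 = None, neutral for [vmin]. *)
Definition truncation mu q f : option G :=
  \big[@vmin G/None]_(l < size f) mu (qcoef q f l * q ^+ l).

Definition complete_set (Q : set {poly K}) mu : Prop :=
  (forall q, Q q -> q \is monic /\ (1 < size q)%N) /\
  (forall f, (1 < size f)%N ->
     exists q, [/\ Q q, (size q <= size f)%N & mu f = truncation mu q f]).

End Truncation.

(* The set of A-linear combinations of elements of S; it is the A-submodule
   generated by S when A is a subring of K. *)
Definition generated_module (K : fieldType) (L : lmodType K)
    (A : set K) (S : set L) : set L :=
  [set z | exists n (c : 'I_n -> K) (s : 'I_n -> L),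
     [/\ forall j, A (c j), forall j, S (s j) & z = \sum_j c j *: s j]].

Definition monomial_value (K : fieldType) (L : fieldExtType K) (eta : L)
    (I : choiceType) (Q : I -> {poly K}) (lam : {fsfun I -> nat with 0%N}) : L :=
  \prod_(i <- finsupp lam) horner_alg eta (Q i) ^+ lam i.

(* Main.v *)
(* Distinct elements of the initial part of vL lie in distinct cosets of vK.  As
   e = (vL : vK) <= [L : K] is finite, the equality of e with the initial index
   forces every coset to meet the initial part.  So a_lam can be chosen with
   0 <= v(Q(eta)^lam / a_lam) < (vK)_{>0} whenever Q(eta)^lam != 0.  Completeness
   of Q, applied to f and then recursively to the coefficients of its
   q-expansion, writes f(eta) as a sum of terms c Q(eta)^lam, none of value
   smaller than v(f(eta)).  If f(eta) is in O_L, then v(c a_lam) < 0 would give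
   v(Q(eta)^lam / a_lam) < - v(c a_lam), hence v(c Q(eta)^lam) < 0; so each
   c a_lam is in O_K. *)
Require Import Defs.
From mathcomp Require Import all_boot all_order all_algebra all_field.
From mathcomp Require Import finmap.
From mathcomp Require Import boolp classical_sets functions cardinality.

Local Open Scope classical_set_scope.
Local Open Scope card_scope.
Local Open Scope ring_scope.

Set Implicit Arguments.
Unset Strict Implicit.
Unset Printing Implicit Defensive.

Import Order.TTheory GRing.Theory Num.Theory.

(** * Ordered abelian groups with infinity adjoined *)

Section ValuesWithInfinity.
Variable G : oagType.
Implicit Types (g h k : G) (x y z : option G).

Lemma oag_lerD2l k g h : (k + g <= k + h) = (g <= h).
Proof.
apply/idP/idP; last exact: oag_leD2l.
by move/(oag_leD2l (- k)); rewrite !addKr.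
Qed.

Lemma oag_ltrD2l k g h : (k + g < k + h) = (g < h).
Proof. by rewrite !lt_neqAle oag_lerD2l (inj_eq (addrI k)). Qed.

Lemma oag_ltNge g h : (g < h) = ~~ (h <= g).
Proof.
have [hg|nhg] := boolP (h <= g).
  by apply/negP => gh; have := lt_le_trans gh hg; rewrite ltxx.
have gh : g <= h by have /orP[//|] := oag_le_total g h; rewrite (negPf nhg).
by rewrite lt_neqAle gh andbT; apply: contraNneq nhg => ->.
Qed.

(** Doubling preserves the sign of [g]. Needed for [v (- 1) = Some 0]. *)
Lemma oag_double_eq0 g : g + g = 0 -> g = 0.
Proof.
move=> g0; apply/eqP/contraT => gN0.
have [g_le|] := boolP (g <= 0); last rewrite -oag_ltNge => g_gt.
  have g_lt : g < 0 by rewrite lt_neqAle gN0.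
  have : g + g < g + 0 by rewrite oag_ltrD2l.
  by rewrite g0 addr0 => /(lt_trans g_lt); rewrite ltxx.
have : g + 0 < g + g by rewrite oag_ltrD2l.
by rewrite g0 addr0 => /(lt_trans g_gt); rewrite ltxx.
Qed.

Lemma vle_refl : reflexive (@vle G).
Proof. by case=> //= g; rewrite lexx. Qed.

Lemma vle_trans : transitive (@vle G).
Proof. by move=> [h|] [g|] [k|] //=; apply: le_trans. Qed.

Lemma vle_total : total (@vle G).
Proof. by move=> [g|] [h|] //=; apply: oag_le_total. Qed.

Lemma vle_anti x y : vle x y -> vle y x -> x = y.
Proof.
by case: x y => [g|] [h|] //= gh hg; congr Some; apply/le_anti/andP.
Qed.

Lemma vle_vmin z x y : vle z (vmin x y) = vle z x && vle z y.
Proof.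
rewrite /vmin; case: ifP => [xy|/negbT xy].
  by have [/vle_trans->|] := boolP (vle z x).
have yx : vle y x by have := vle_total x y; rewrite (negPf xy).
by have [/vle_trans->|] := boolP (vle z y); rewrite ?andbF.
Qed.

(** Used contrapositively: the ultrametric inequality for strict lower bounds, written
    [~~ vle _ z]. *)
Lemma vmin_le_strict z x y : vle (vmin x y) z -> vle x z || vle y z.
Proof. by rewrite /vmin; case: ifP => _ ->; rewrite ?orbT. Qed.

Lemma vle_big_vmin (J : eqType) (r : seq J) (F : J -> option G) z j :
  vle z (\big[@vmin G/None]_(i <- r) F i) -> j \in r -> vle z (F j).
Proof.
elim: r => // i r IHr; rewrite big_cons vle_vmin inE => /andP[zi zr].
by case/predU1P => [->//|]; apply: IHr.
Qed.

Lemma vle_add2r z x y : vle x y -> vle (vadd x z) (vadd y z).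
Proof.
by case: x y z => [g|] [h|] [k|] //=; rewrite -!(addrC k) oag_lerD2l.
Qed.

End ValuesWithInfinity.

(** * Valuations of finite sums in a field *)

Section ValuedFields.
Variables (L : fieldType) (G : oagType) (v : L -> option G).
Hypothesis vP : is_valuation v.

Lemma valuation_inv x : x != 0 ->
  exists2 g, v x = Some g & v x^-1 = Some (- g).
Proof.
move=> x0; have := valuationM vP x x^-1; rewrite mulfV // (valuation1 vP).
case: (v x) (v x^-1) => [g|] [h|] //= [gh]; exists g => //.
by congr Some; apply: (addrI g); rewrite -gh subrr.
Qed.

Lemma valuationN x : v (- x) = v x.
Proof.
rewrite -mulN1r (valuationM vP).
have [g vg _] : exists2 g, v (- 1) = Some g & v (- 1)^-1 = Some (- g).
  by apply: valuation_inv; rewrite oppr_eq0 oner_eq0.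
have := valuationM vP (- 1) (- 1).
rewrite mulrNN mulr1 (valuation1 vP) vg /= => -[/esym/oag_double_eq0->].
by case: (v x) => //= h; rewrite add0r.
Qed.

Lemma vle_valuation_sum (J : finType) (P : pred J) (F : J -> L) z :
  (forall j, P j -> vle z (v (F j))) -> vle z (v (\sum_(j | P j) F j)).
Proof.
move=> zF; apply: (big_ind (fun x => vle z (v x))) => // [|x y zx zy].
  by rewrite (valuation0 vP).
by apply: vle_trans (valuationD vP x y); rewrite vle_vmin zx.
Qed.

(** The bound is finite, so the empty sum, of value [None], also lies strictly above it. *)
Lemma vgt_valuation_sum (J : finType) (P : pred J) (F : J -> L) g :
    (forall j, P j -> ~~ vle (v (F j)) (Some g)) ->
  ~~ vle (v (\sum_(j | P j) F j)) (Some g).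
Proof.
move=> gF; apply: (big_ind (fun x => ~~ vle (v x) (Some g))) => // [|x y].
  by rewrite (valuation0 vP).
move=> gx gy; apply/negP => /(vle_trans (valuationD vP x y)) /vmin_le_strict.
by rewrite (negPf gx) (negPf gy).
Qed.

(** If only one nonzero term had the least value, it would be minus a sum of strictly larger
    value. *)
Lemma min_valuation_not_uniq (J : finType) (F : J -> L) i :
    \sum_j F j = 0 -> F i != 0 ->
  exists i1 i2, [/\ i1 != i2, F i1 != 0, F i2 != 0 & v (F i1) = v (F i2)].
Proof.
move=> F0 Fi.
case: (extremumP (P := fun j => F j != 0) (v \o F) (@vle_refl G)
         (@vle_trans G) (@vle_total G) Fi).
move=> i1 /= Fi1 min_i1; have [g vg _] := valuation_inv Fi1.
apply: contrapT => uniq.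
have : ~~ vle (v (\sum_(j | j != i1) F j)) (Some g).
  apply: vgt_valuation_sum => j ji1; apply/negP => Fj_le.
  have Fj : F j != 0.
    by apply/eqP => Fj0; move: Fj_le; rewrite Fj0 (valuation0 vP).
  apply: uniq; exists i1, j; split=> //; first by rewrite eq_sym.
  by apply: vle_anti; rewrite ?min_i1 // vg.
move: F0; rewrite (bigD1 i1) //= => /eqP; rewrite addr_eq0 => /eqP Fi1E.
by rewrite -valuationN -Fi1E vg /= lexx.
Qed.

End ValuedFields.

(** * The initial part of an ordered group and its cosets *)

Section InitialIndex.
Variable (G : oagType).
Implicit Types Gam Del : set G.

Definition subgroup Del := Del 0 /\ forall g h, Del g -> Del h -> Del (g - h).

Lemma coset_eqP Del g h : subgroup Del ->
  [set g + d | d in Del] = [set h + d | d in Del] <-> Del (g - h).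
Proof.
move=> [D0 DB]; split=> [gh|Dgh].
  have : [set g + d | d in Del] g by exists 0; rewrite ?addr0.
  by rewrite gh => -[d Dd <-]; rewrite addrAC subrr add0r.
have Dhg : Del (h - g) by rewrite -opprB -sub0r; apply: DB.
have DD d e : Del d -> Del e -> Del (d + e).
  by move=> Dd De; rewrite -[e]opprK -[- e]sub0r; apply/DB/DB.
apply/seteqP; split=> _ [d Dd <-].
  by exists ((g - h) + d); [apply: DD | rewrite addrA [h + _]addrC subrK].
by exists ((h - g) + d); [apply: DD | rewrite addrA [g + _]addrC subrK].
Qed.

(** If [h < g] and [g - h] is in [Del], then [g - h] is a positive element of [Del], so [g < g - h];
    this contradicts [0 <= h]. *)
Lemma initial_part_coset_inj Gam Del : subgroup Del ->
  {in initial_part Gam Del &, injective (fun g => [set g + d | d in Del])}.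
Proof.
move=> [D0 DB].
have wlog_le g h : initial_part Gam Del g -> initial_part Gam Del h ->
    Del (g - h) -> g <= h.
  move=> [_ _ g_lt] [_ h_ge _] Dgh.
  rewrite -[_ <= _]negbK -oag_ltNge; apply/negP => hg.
  have : g < g - h.
    by apply: g_lt; rewrite // -(oag_ltrD2l h) addr0 addrCA subrr addr0.
  rewrite -{1}[g]addr0 oag_ltrD2l -(oag_ltrD2l h) addr0 subrr => h_lt.
  by have := le_lt_trans h_ge h_lt; rewrite ltxx.
move=> g h /set_mem gI /set_mem hI /= gh; apply/le_anti/andP; split.
  by apply: wlog_le => //; apply/coset_eqP.
by apply: wlog_le => //; apply/coset_eqP.
Qed.

Lemma subset_card_eq (T : choiceType) (A B : set T) :
  finite_set B -> A `<=` B -> A #= B -> A = B.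
Proof.
move=> finB AB; have finA := sub_finite_set AB finB.
move/(fcard_eq finA finB) => cAB.
apply: fset_set_inj => //; apply/eqP.
by rewrite eqEfcard cAB leqnn andbT -fset_set_sub.
Qed.

Lemma initial_part_meets_cosets Gam Del g : subgroup Del ->
    finite_set (cosets Gam Del) -> initial_part Gam Del #= cosets Gam Del ->
    Gam g ->
  exists2 h, initial_part Gam Del h & Del (g - h).
Proof.
move=> sgD finC cIC Gg; set cos := fun h => [set h + d | d in Del].
have : [set cos h | h in initial_part Gam Del] = cosets Gam Del.
  apply: subset_card_eq => // [_ [h [Gh _ _] <-]|]; first by exists h.
  apply: card_eq_trans cIC.
  exact/inj_card_eq/initial_part_coset_inj.
move/seteqP => [_ /(_ (cos g))] [|h hI /esym/coset_eqP]; first by exists g.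
by exists h => //; auto.
Qed.

End InitialIndex.

(** * Finiteness of the ramification index *)

Section ValuedExtension.
Variables (K : fieldType) (L : fieldExtType K) (G : oagType).
Variable v : L -> option G.
Hypothesis vP : is_valuation v.
Let vK (a : K) := v a%:A.

Lemma valuationZ a x : v (a *: x) = vadd (vK a) (v x).
Proof. by rewrite -mulr_algl (valuationM vP). Qed.

Lemma base_valuation_inv a : a != 0 ->
  exists2 g, vK a = Some g & vK a^-1 = Some (- g).
Proof.
move=> a0; have [|g vg vgV] := valuation_inv vP (x := a%:A).
  by rewrite scaler_eq0 oner_eq0 orbF.
by exists g; rewrite // /vK -[a^-1%:A]/(in_alg L a^-1) fmorphV.
Qed.

Lemma base_value_neq0 a g : vK a = Some g -> a != 0.
Proof. by apply: contraPneq => ->; rewrite /vK scale0r (valuation0 vP). Qed.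

Lemma value_group_subgroup : subgroup (value_group vK).
Proof.
split=> [|g h [a va] [b vb]]; first by exists 1; rewrite /vK scale1r valuation1.
have [h' vb' vbV] := base_valuation_inv (base_value_neq0 vb).
exists (a * b^-1); rewrite /vK -scalerA valuationZ -/(vK _) va.
by rewrite -/(vK _) vbV; move: vb'; rewrite vb => -[->].
Qed.

(* This is the inequality e <= [L : K]; it makes e finite. *)
Lemma leq_dim_distinct_cosets n (x : 'I_n -> L) :
    (forall i j a b, i != j -> a *: x i != 0 -> b *: x j != 0 ->
       v (a *: x i) <> v (b *: x j)) ->
    (forall i, x i != 0) ->
  (n <= \dim {:L})%N.
Proof.
move=> vx x0; suff /eqP : free [tuple x i | i < n].
  by rewrite size_tuple => <-; rewrite dimvS ?subvf.
apply/freeP => k; under eq_bigr do rewrite -tnth_nth tnth_mktuple.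
move=> kx0 i; apply/eqP/contraT => ki.
(* A nontrivial relation would have two nonzero terms of equal value. *)
have [|i1 [i2 [i12 + +]]] := min_valuation_not_uniq vP (i := i) kx0.
  by rewrite scaler_eq0 negb_or ki x0.
by move=> ? ? /vx[].
Qed.

Lemma finite_cosets : finite_set (cosets (value_group v) (value_group vK)).
Proof.
apply: contrapT => /infiniteP/pcard_leP[f].
have fP n : cosets (value_group v) (value_group vK) (f n) by apply: funS.
have /choice[x xP] : forall n, exists y, exists2 g, v y = Some g &
    f n = [set g + d | d in value_group vK].
  by move=> n; have [g [y vy] gE] := fP n; exists y, g.
(* Infinitely many cosets would provide one more representative than the dimension allows. *)
suff : ((\dim {:L}).+1 <= \dim {:L})%N by rewrite ltnn.
apply: (@leq_dim_distinct_cosets _ (x \o val)) => [i j a b|i]; last first.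
  have [g vg _] := xP i.
  by apply/eqP => /= x0; move: vg; rewrite x0 (valuation0 vP).
move=> ij; rewrite /= !scaler_eq0 !negb_or => /andP[a0 _] /andP[b0 _].
have [g vg fi] := xP i; have [h vh fj] := xP j.
have [a' va _] := base_valuation_inv a0.
have [b' vb _] := base_valuation_inv b0.
rewrite !valuationZ va vb vg vh /= => -[abE].
move/eqP: ij; apply; apply: val_inj.
(* Equal values of the multiples by [a] and [b] place [x i] and [x j] in the same coset. *)
have /coset_eqP : value_group vK (g - h).
  have -> : g - h = b' - a'.
    by apply: (addrI a'); rewrite addrA abE addrK addrC subrK.
  by apply: (value_group_subgroup.2); [exists b|exists a].
move=> /(_ value_group_subgroup); rewrite -fi -fj => /(@inj _ _ _ f).
by rewrite !inE; apply.
Qed.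

End ValuedExtension.

(** * Closure properties of the generated module *)

Section GeneratedModule.
Variables (K : fieldType) (L : lmodType K) (A : set K) (S : set L).

Lemma generated_module0 : generated_module A S 0.
Proof.
exists 0%N, (fun=> 0), (fun=> 0); split; [by case | by case |].
by rewrite big_ord0.
Qed.

Lemma generated_moduleD x y :
  generated_module A S x -> generated_module A S y ->
  generated_module A S (x + y).
Proof.
move=> [m [c [s [cA sS ->]]]] [n [d [t [dA tS ->]]]].
exists (m + n)%N, (fun j => match fintype.split j with inl i => c i | inr i => d i end).
exists (fun j => match fintype.split j with inl i => s i | inr i => t i end).
split=> [j|j|]; try by case: (fintype.split j).
rewrite big_split_ord; congr (_ + _); apply: eq_bigr => i _.
  by rewrite -[lshift n i]/(unsplit (inl i)) unsplitK.
by rewrite -[rshift m i]/(unsplit (inr i)) unsplitK.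
Qed.

Lemma generated_module_scale a x :
  A a -> S x -> generated_module A S (a *: x).
Proof.
move=> Aa Sx; exists 1%N, (fun=> a), (fun=> x).
by split=> //; rewrite big_ord_recl big_ord0 addr0.
Qed.

End GeneratedModule.

(** * Monomials in the values of the [Q i] at [eta] *)

Section MonomialValues.
Variables (K : fieldType) (L : fieldExtType K) (eta : L).
Variables (I : choiceType) (Q : I -> {poly K}).
Implicit Type lam : {fsfun I -> nat with 0%N}.

Lemma monomial_value_widen lam (S : {fset I}) : (finsupp lam `<=` S)%fset ->
  monomial_value eta Q lam = \prod_(i <- S) horner_alg eta (Q i) ^+ lam i.
Proof.
move=> lamS; apply: big_fset_incl => // i _ i_lam.
by rewrite fsfun_dflt // expr0.
Qed.

Lemma monomial_value_mulX lam i l : exists lam',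
  monomial_value eta Q lam' =
    horner_alg eta (Q i) ^+ l * monomial_value eta Q lam.
Proof.
(* [i] may lie outside either support, for instance when the new exponent is 0, so both products are
   taken over the common set [S]. *)
pose S := (i |` finsupp lam)%fset.
exists [fsfun lam with i |-> (l + lam i)%N].
rewrite (@monomial_value_widen lam S) ?fsubsetU1 //.
rewrite (@monomial_value_widen _ S); last first.
  rewrite finsupp_with; case: ifP => _; last exact: fsubset_refl.
  by rewrite (fsubset_trans (fsubsetDl _ _)) ?fsubsetU1.
have iS : i \in S by rewrite !inE eqxx.
rewrite (big_fsetD1 i iS) [in RHS](big_fsetD1 i iS) /= mulrA -exprD.
rewrite fsfun_withE eqxx; congr (_ * _).
apply: eq_big_seq => j; rewrite !inE => /andP[ji _].
by rewrite fsfun_withE (negPf ji).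
Qed.

Lemma monomial_value0 : monomial_value eta Q [fsfun] = 1.
Proof. by rewrite /monomial_value finsupp0 big_seq_fset0. Qed.

End MonomialValues.

Lemma Fadjoin_full_horner_alg (K : fieldType) (L : fieldExtType K) (eta z : L) :
  <<1; eta>>%VS = fullv -> exists f, z = horner_alg eta f.
Proof.
move=> gen; have : z \in <<1; eta>>%VS by rewrite gen memvf.
by move=> /Fadjoin_polyP[_ /polyOver1P[f ->] ->]; exists f.
Qed.

(** * Expansion along a complete set without loss of value *)

Section CompleteSet.
Variables (K : fieldType) (L : fieldExtType K) (G : oagType).
Variables (v : L -> option G) (eta : L) (I : choiceType) (Q : I -> {poly K}).
Hypothesis vP : is_valuation v.
Hypothesis Qcomplete : complete_set (range Q) (fun f => v (horner_alg eta f)).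

(* Induction on the size of f, generalizing lam: the digits f_l of the
   q-expansion of f are smaller than f, and none of the terms f_l * q ^+ l has
   smaller value than f. *)
Lemma complete_set_ind (M : set L) (m : option G) :
    M 0 -> (forall x y, M x -> M y -> M (x + y)) ->
    (forall c lam, vle m (v (c *: monomial_value eta Q lam)) ->
       M (c *: monomial_value eta Q lam)) ->
  forall f lam, vle m (v (horner_alg eta f * monomial_value eta Q lam)) ->
    M (horner_alg eta f * monomial_value eta Q lam).
Proof.
move=> M0 MD Mmon f; have [n] := ubnP (size f).
elim: n f => // n IHn f; rewrite ltnS => fn lam.
have [f1|f1] := leqP (size f) 1.
  by rewrite (size1_polyC f1) horner_algC mulr_algl; apply: Mmon.
have [Qmonic /(_ f f1)[_ [[i _ <-] qf nuf]]] := Qcomplete.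
have [_ q1] := Qmonic (Q i) (imageT Q i).
rewrite {2}(qexpansion f q1) rmorph_sum /= mulr_suml => mf.
apply: (big_ind M) => // l _; rewrite rmorphM rmorphXn /= -mulrA.
(* Absorbing the power of [Q i] into the monomial leaves only the digit, which is smaller than [f],
   for the induction hypothesis. *)
have [lam' lam'E] := monomial_value_mulX eta Q lam i l.
rewrite -lam'E; apply: IHn.
  exact: leq_trans (size_qcoef f l q1) (leq_trans qf fn).
apply: vle_trans mf _; rewrite lam'E mulrA -rmorphXn -rmorphM !(valuationM vP).
apply: vle_add2r; have := vle_refl (v (horner_alg eta f)); rewrite {2}nuf.
by move/vle_big_vmin; apply; rewrite mem_index_enum.
Qed.

End CompleteSet.

(** * Choice of the denominators and the two inclusions *)

Theorem theorem1p1 (K : fieldType) (L : fieldExtType K) (G : oagType)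
    (v : L -> option G) (eta : L) (I : choiceType) (Q : I -> {poly K})
    (vK := fun a : K => v a%:A) (nu := fun f : {poly K} => v (horner_alg eta f)) :
  is_valuation v ->
  initial_part (value_group v) (value_group vK)
    #= cosets (value_group v) (value_group vK) ->
  <<1; eta>>%VS = fullv ->
  complete_set (range Q) nu ->
  exists a : {fsfun I -> nat with 0%N} -> K,
    (forall lam, a lam != 0) /\
    valuation_ring v =
      generated_module (valuation_ring vK)
        (range (fun lam => monomial_value eta Q lam / (a lam)%:A)).
Proof.
move=> vP eps_e gen Qcomplete.
have /choice[a aP] : forall lam, exists a : K, a != 0 /\
    (monomial_value eta Q lam != 0 ->
     exists2 g, initial_part (value_group v) (value_group vK) g &
       v (monomial_value eta Q lam / a%:A) = Some g).
  move=> lam; have [->|y0] := eqVneq (monomial_value eta Q lam) 0.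
    (* A vanishing monomial yields the generator 0 whatever the denominator. *)
    by exists 1; rewrite oner_neq0.
  have [g vy _] := valuation_inv vP y0.
  (* The denominator [b] has value [g - h], which moves the value [g] of the monomial to [h] in the
     initial part. *)
  have [|h hI [b vb]] := initial_part_meets_cosets
    (value_group_subgroup vP) (finite_cosets vP) eps_e (g := g).
    by exists (monomial_value eta Q lam).
  have b0 := base_value_neq0 vP vb; exists b; split=> // _; exists h => //.
  have [k + vbV] := base_valuation_inv vP b0; rewrite vb => -[gh].
  rewrite (valuationM vP) vy -[b%:A]/(in_alg L b) -fmorphV vbV -gh /=.
  by congr Some; rewrite opprB addrC subrK.
have a0 lam := (aP lam).1; exists a; split=> //; apply/seteqP; split.
  move=> z vz; have [f zf] := Fadjoin_full_horner_alg z gen.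
  (* The empty monomial is 1, so the induction starts from [z] itself, with lower bound 0. *)
  have := complete_set_ind vP Qcomplete (m := Some 0) (generated_module0 _ _)
    (@generated_moduleD _ _ _ _) _ (f := f) (lam := [fsfun]).
  rewrite monomial_value0 mulr1 -zf; apply=> // c lam.
  have [->|y0] := eqVneq (monomial_value eta Q lam) 0.
    by rewrite scaler0 => _; apply: generated_module0.
  (* For nonzero [c], the scalar [c * a lam] has an inverse, whose value is compared with [g]
     below. *)
  have [->|c0] := eqVneq c 0.
    by rewrite scale0r => _; apply: generated_module0.
  have [g [_ g0 g_lt] vya] := (aP lam).2 y0.
  have -> : c *: monomial_value eta Q lam =
      (c * a lam) *: (monomial_value eta Q lam / (a lam)%:A).
    rewrite -[(a lam)%:A]/(in_alg L _) -fmorphV /= mulr_algr scalerA.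
    by rewrite mulfK.
  rewrite (valuationZ vP) vya => vcy; apply: generated_module_scale => //.
  have ca0 : c * a lam != 0 by rewrite mulf_neq0.
  have [d vd vdV] := base_valuation_inv vP ca0.
  move: vcy; rewrite /valuation_ring /= /vK vd /= => dg.
  rewrite -[_ <= _]negbK -oag_ltNge; apply/negP => d0.
  have : g < - d.
    apply: g_lt; first by exists (c * a lam)^-1.
    by rewrite -(oag_ltrD2l d) subrr addr0.
  by rewrite -(oag_ltrD2l d) subrr oag_ltNge dg.
(* Conversely, each generator is 0 or has its value in the initial part, hence at least 0. *)
move=> _ [n [c [s [cO sS ->]]]]; apply: (vle_valuation_sum vP) => j _.
have [lam _ <-] := sS j; rewrite (valuationZ vP).
have [->|y0] := eqVneq (monomial_value eta Q lam) 0.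
  by rewrite mul0r (valuation0 vP); case: (v _).
have [g [_ g0 _] ->] := (aP lam).2 y0.
apply: vle_trans (vle_add2r (Some g) (cO j)).
by rewrite /= add0r.
Qed.
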